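(* Let $C$ be a conjugation on $H^2$. Then there exist complex numbers $b_m^{(n)}$ ($n,m=0,1,2,\ldots$) such that, for each $n\ge 0$, the sequence $\{b_m^{(n)}\}_{m=0}^\infty$ is square summable, i.e. $\sum_{m=0}^\infty|b_m^{(n)}|^2<\infty$, and such that for every $f(z)=\sum_{n=0}^\infty a_n z^n\in H^2$, $$C\left(\sum_{n=0}^{\infty}a_n z^n\right)=\sum_{n=0}^{\infty}\sum_{m=0}^{\infty}\overline{a_n}\,b_m^{(n)}z^m.$$
   Context: $\mathbb{D}$ is the open unit disk in $\mathbb{C}$ and $\mathbb{T}$ is its boundary, the unit circle. $H^2$ is the Hardy space of holomorphic functions $f$ on $\mathbb{D}$ with $\sup_{0<r<1}\int_{\mathbb{T}}|f(r\xi)|^2\,d\sigma(\xi)<\infty$, where $\sigma$ is the normalized Haar measure on $\mathbb{T}$. Equivalently, $H^2$ consists of the functions $f(z)=\sum_{n=0}^\infty a_n z^n$ with $\sum_{n=0}^\infty|a_n|^2<\infty$. It is a separable complex Hilbert space with orthonormal basis $\{z^n:n=0,1,2,\ldots\}$, so $\langle \sum a_n z^n,\sum b_n z^n\rangle=\sum_n a_n\overline{b_n}$. A conjugation on a separable complex Hilbert space $\mathcal{H}$ is an antilinear operator $C:\mathcal{H}\to\mathcal{H}$ such that (a) $\langle Cf,Cg\rangle=\langle g,f\rangle$ for all $f,g\in\mathcal{H}$, and (b) $C^2=I$. The double series is an iterated sum: for each $n$ the inner series over $m$ converges in the norm of $H^2$, and then the series over $n$ converges in the norm of $H^2$. *)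

(* Defs.v *)
(* Stdlib's real numbers and Coquelicot's complex numbers. *)
From Stdlib Require Import Reals Lra Lia Psatz.
From Stdlib Require Import FunctionalExtensionality ProofIrrelevance ClassicalEpsilon.
From Coquelicot Require Import Coquelicot.

Open Scope R_scope.

Record Disc : Type := mkDisc { dval : C; dval_lt : Cmod dval < 1 }.

Definition square_summable (a : nat -> C) : Prop :=
  ex_series (fun n => Cmod (a n) ^ 2).

Definition power_expansion (f : Disc -> C) (a : nat -> C) : Prop :=
  forall z : Disc, is_pseries (K := C_AbsRing) (V := C_NormedModule) a (dval z) (f z).

(* The coefficient description of the Hardy space: such an [f] is automatically
   holomorphic, since a square summable power series converges on the disc. *)
Definition in_H2 (f : Disc -> C) : Prop :=
  exists a : nat -> C, square_summable a /\ power_expansion f a.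

Record H2 : Type := mkH2 { hfun :> Disc -> C; hfun_in_H2 : in_H2 hfun }.

(* The Taylor coefficients; their uniqueness is [coef_unique] below. *)
Definition coef (f : H2) : nat -> C :=
  proj1_sig (constructive_indefinite_description _ (hfun_in_H2 f)).

(* Coquelicot's [Series] is real-valued and total. In [hdot] both component
   series converge absolutely, by square summability. *)
Definition CSeries (u : nat -> C) : C :=
  (Series (fun n => Re (u n)), Series (fun n => Im (u n))).

Definition hdot (f g : H2) : C :=
  CSeries (fun n => (coef f n * Cconj (coef g n))%C).

Definition hnorm (f : H2) : R := sqrt (Re (hdot f f)).

Lemma coef_ssum (f : H2) : square_summable (coef f).
Proof.
unfold coef.
now destruct (constructive_indefinite_description _ (hfun_in_H2 f)) as [a [Ha Hf]].
Qed.

Lemma coef_expansion (f : H2) : power_expansion f (coef f).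
Proof.
unfold coef.
now destruct (constructive_indefinite_description _ (hfun_in_H2 f)) as [a [Ha Hf]].
Qed.

Lemma pow_n_Cmod (z : C) (n : nat) :
  Cmod (pow_n (K := C_AbsRing) z n) = Cmod z ^ n.
Proof.
induction n as [|n IH].
- exact Cmod_1.
- change (pow_n z (S n)) with (Cmult z (pow_n (K := C_AbsRing) z n)).
  rewrite Cmod_mult, IH; reflexivity.
Qed.

Lemma expansion_ext (f g : Disc -> C) (a : nat -> C) :
  power_expansion f a -> power_expansion g a -> f = g.
Proof.
intros Hf Hg; apply functional_extensionality; intros z.
exact (filterlim_locally_unique _ _ _ (Hf z) (Hg z)).
Qed.

Lemma is_series_single {K : AbsRing} {V : NormedModule K} (u : nat -> V) (n : nat) :
  (forall k, k <> n -> u k = zero) -> is_series u (u n).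
Proof.
intros Hu.
assert (B : forall N, (N < n)%nat -> sum_n u N = zero).
{ induction N as [|N IH]; intros HN.
  - rewrite sum_O; apply Hu; lia.
  - rewrite sum_Sn, IH, Hu, plus_zero_l by lia; reflexivity. }
assert (A : forall N, (n <= N)%nat -> sum_n u N = u n).
{ intros N HN; induction HN as [|N HN IH].
  - destruct n as [|n]; [apply sum_O |].
    rewrite sum_Sn, B, plus_zero_l by lia; reflexivity.
  - rewrite sum_Sn, IH, (Hu (S N)), plus_zero_r by lia; reflexivity. }
apply filterlim_ext_loc with (fun _ => u n); [| apply filterlim_const].
exists n; intros N HN; symmetry; now apply A.
Qed.

Lemma sum_geom_half (u : nat -> C) (M : R) :
  (forall n, Cmod (u n) <= M * (/ 2) ^ n) ->
  forall N, Cmod (sum_n (G := C_AbelianMonoid) u N) <= M * (2 - (/ 2) ^ N).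
Proof.
intros Hu N; induction N as [|N IH].
- rewrite sum_O; generalize (Hu O); simpl; lra.
- rewrite sum_Sn.
  change (plus (sum_n u N) (u (S N)))
    with (Cplus (sum_n (G := C_AbelianMonoid) u N) (u (S N))).
  apply Rle_trans with (1 := Cmod_triangle _ _).
  generalize (Hu (S N)); simpl; lra.
Qed.

Lemma pseries_zero_bound (a : nat -> C) (M : R) (x : C) :
  (forall n, Cmod (a n) <= M) -> 0 < Cmod x <= / 2 ->
  is_pseries (K := C_AbsRing) (V := C_NormedModule) a x zero ->
  Cmod (a O) <= 2 * M * Cmod x.
Proof.
intros Ha [Hx0 Hx] H.
assert (x0 : x <> 0%C) by (apply Cmod_gt_0; exact Hx0).
assert (HM : 0 <= M) by (apply Rle_trans with (2 := Ha O); apply Cmod_ge_0).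
assert (inv : mult (Cinv x : C_AbsRing) (x : C_AbsRing) = one)
  by exact (Cinv_l x x0).
apply (is_pseries_decr_1 _ _ _ _ inv) in H.
assert (L : is_lim_seq
  (fun N => Cmod (sum_n (G := C_AbelianMonoid)
     (fun k => Cmult (pow_n (K := C_AbsRing) x k) (a (S k))) N))
  (Cmod (Cmult (/ x) (Cplus 0 (Copp (a O)))))).
{ exact (filterlim_comp _ _ _ _ norm _ _ _ H (filterlim_norm _)). }
assert (B : Cmod (Cmult (/ x) (Cplus 0 (Copp (a O)))) <= 2 * M).
{ refine (is_lim_seq_le _ _ (Finite _) (Finite (2 * M)) _ L (is_lim_seq_const _)).
  intros N.
  apply Rle_trans with (M * (2 - (/ 2) ^ N)).
  - apply sum_geom_half; intros k.
    rewrite Cmod_mult, pow_n_Cmod, Rmult_comm.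
    apply Rmult_le_compat; [apply Cmod_ge_0 | apply pow_le, Cmod_ge_0 | apply Ha |].
    apply pow_incr; split; [apply Cmod_ge_0 | exact Hx].
  - assert (0 < (/ 2) ^ N) by (apply pow_lt; lra).
    nra. }
rewrite Cplus_0_l, Cmod_mult, Cmod_opp, Cmod_inv in B by exact x0.
apply Rmult_le_compat_r with (r := Cmod x) in B; [| lra].
field_simplify in B; lra.
Qed.

(* The centre is excluded so that the property survives division by [x]. *)
Definition vanishing_expansion (a : nat -> C) : Prop :=
  forall x : C, 0 < Cmod x <= / 2 ->
    is_pseries (K := C_AbsRing) (V := C_NormedModule) a x zero.

Lemma vanishing_expansion_0 (a : nat -> C) (M : R) :
  (forall n, Cmod (a n) <= M) -> vanishing_expansion a -> a O = 0%C.
Proof.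
intros Ha H.
apply Cmod_eq_0, Rle_antisym; [| apply Cmod_ge_0].
apply le_epsilon; intros eps Heps; rewrite Rplus_0_l.
assert (HM : 0 <= M) by (apply Rle_trans with (2 := Ha O); apply Cmod_ge_0).
set (t := Rmin (/ 2) (eps / (2 * (M + 1)))).
assert (Ht : 0 < t).
{ apply Rmin_glb_lt; [lra | apply Rdiv_lt_0_compat; lra]. }
assert (Ct : Cmod (RtoC t) = t) by (rewrite Cmod_R; apply Rabs_pos_eq; lra).
apply Rle_trans with (2 * M * Cmod (RtoC t)).
- assert (R2 : 0 < Cmod (RtoC t) <= / 2)
    by (rewrite Ct; split; [exact Ht | apply Rmin_l]).
  apply pseries_zero_bound; [exact Ha | exact R2 | exact (H _ R2)].
- rewrite Ct.
  apply Rle_trans with (2 * (M + 1) * t); [nra |].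
  apply Rle_trans with (2 * (M + 1) * (eps / (2 * (M + 1)))).
  + apply Rmult_le_compat_l; [lra | apply Rmin_r].
  + right; field; lra.
Qed.

Lemma vanishing_expansion_eq0 (a : nat -> C) (M : R) :
  (forall n, Cmod (a n) <= M) -> vanishing_expansion a -> forall n, a n = 0%C.
Proof.
intros Ha H n; revert a Ha H; induction n as [|n IH]; intros a Ha H.
- now apply vanishing_expansion_0 with M.
- assert (a0 := vanishing_expansion_0 a M Ha H).
  apply (IH (fun k => a (S k))).
  + intros k; apply Ha.
  + intros x Hx.
    assert (x0 : x <> 0%C) by (apply Cmod_gt_0, Hx).
    assert (inv : mult (Cinv x : C_AbsRing) (x : C_AbsRing) = one)
      by exact (Cinv_l x x0).
    assert (h := is_pseries_decr_1 _ _ _ _ inv (H x Hx)).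
    refine (eq_ind _ (is_pseries (V := C_NormedModule) _ x) h _ _).
    rewrite a0.
    change (Cmult (/ x) (Cplus 0 (Copp 0)) = 0%C); ring.
Qed.

Lemma Series_nonneg (u : nat -> R) :
  (forall n, 0 <= u n) -> ex_series u -> 0 <= Series u.
Proof.
intros Hu Su.
rewrite <- (Rmult_0_l (Series u)), <- Series_scal_l.
apply Series_le; [| exact Su].
intros n; rewrite Rmult_0_l; split; [lra | apply Hu].
Qed.

Lemma Series_nonneg_ge_term (u : nat -> R) (n : nat) :
  (forall k, 0 <= u k) -> ex_series u -> u n <= Series u.
Proof.
intros Hu Su.
rewrite (Series_incr_n _ (S n)); [| apply Nat.lt_0_succ | exact Su].
simpl pred.
assert (P : 0 <= Series (fun k => u (S n + k)%nat)).
{ apply Series_nonneg; [intros k; apply Hu |].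
  exact (proj1 (ex_series_incr_n u (S n)) Su). }
assert (Q : u n <= sum_f_R0 u n).
{ destruct n as [|n]; [simpl; lra |].
  rewrite tech5.
  assert (0 <= sum_f_R0 u n) by (apply cond_pos_sum; exact Hu).
  lra. }
lra.
Qed.

Lemma ssum_bounded (a : nat -> C) :
  square_summable a -> exists M, forall n, Cmod (a n) <= M.
Proof.
intros Ha; exists (Series (fun n => Cmod (a n) ^ 2) + 1); intros n.
assert (T : Cmod (a n) ^ 2 <= Series (fun n => Cmod (a n) ^ 2)).
{ exact (Series_nonneg_ge_term (fun n => Cmod (a n) ^ 2) n
           (fun k => pow2_ge_0 _) Ha). }
assert (0 <= (Cmod (a n) - 1) ^ 2) by apply pow2_ge_0.
generalize (Cmod_ge_0 (a n)); nra.
Qed.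

Lemma ssum_lincomb (c : C) (a b : nat -> C) :
  square_summable a -> square_summable b ->
  square_summable (fun n => Cplus (a n) (Cmult c (b n))).
Proof.
intros Ha Hb.
apply (@ex_series_le R_AbsRing R_CompleteNormedModule) with
  (fun n => 2 * Cmod (a n) ^ 2 + 2 * Cmod c ^ 2 * Cmod (b n) ^ 2).
- intros n; unfold norm; simpl; unfold abs; simpl.
  rewrite Rabs_pos_eq; [| apply (pow2_ge_0 (Cmod _))].
  assert (T := Cmod_triangle (a n) (c * b n)%C).
  rewrite Cmod_mult in T.
  assert (U := Cmod_ge_0 (a n + c * b n)%C).
  assert (V := pow2_ge_0 (Cmod (a n) - Cmod c * Cmod (b n))).
  nra.
- apply (ex_series_plus (K := R_AbsRing) (V := R_NormedModule));
    apply (ex_series_scal (K := R_AbsRing) (V := R_NormedModule)); assumption.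
Qed.

Lemma expansion_lincomb (c : C) (f g : Disc -> C) (a b : nat -> C) :
  power_expansion f a -> power_expansion g b ->
  power_expansion (fun z => Cplus (f z) (Cmult c (g z)))
    (fun n => Cplus (a n) (Cmult c (b n))).
Proof.
intros Hf Hg z.
apply (is_pseries_plus (V := C_NormedModule)); [apply Hf |].
apply (is_pseries_scal (V := C_NormedModule)); [| apply Hg].
exact (Cmult_comm _ _).
Qed.

Lemma expansion_unique (f : Disc -> C) (a b : nat -> C) :
  square_summable a -> square_summable b ->
  power_expansion f a -> power_expansion f b -> forall n, a n = b n.
Proof.
intros Sa Sb Ha Hb n.
assert (Hd := expansion_lincomb (-1) _ _ _ _ Ha Hb).
destruct (ssum_bounded _ (ssum_lincomb (-1) _ _ Sa Sb)) as [M HM].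
assert (E : (a n + -1 * b n)%C = 0%C).
{ apply (vanishing_expansion_eq0 _ M HM).
  intros x Hx.
  assert (x1 : Cmod x < 1) by lra.
  generalize (Hd (mkDisc x x1)); simpl.
  replace (Cplus (f (mkDisc x x1)) (Cmult (-1) (f (mkDisc x x1)))) with (RtoC 0) by ring.
  exact (fun h => h). }
replace (a n) with ((a n + -1 * b n) + b n)%C by ring.
rewrite E; ring.
Qed.

Lemma coef_unique (f : H2) (a : nat -> C) :
  square_summable a -> power_expansion f a -> forall n, coef f n = a n.
Proof.
intros Sa Ha; apply (expansion_unique f); trivial;
  [apply coef_ssum | apply coef_expansion].
Qed.

Lemma H2_ext (f g : H2) : (forall z, f z = g z) -> f = g.
Proof.
destruct f as [f Hf], g as [g Hg]; simpl; intros E.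
apply functional_extensionality in E; subst g.
f_equal; apply proof_irrelevance.
Qed.

Lemma H2_ext_coef (f g : H2) : (forall n, coef f n = coef g n) -> f = g.
Proof.
intros E; apply functional_extensionality in E; apply H2_ext; intros z.
assert (Hf := coef_expansion f); rewrite E in Hf.
now rewrite (expansion_ext _ _ _ Hf (coef_expansion g)).
Qed.

Lemma in_H2_lincomb (c : C) (f g : Disc -> C) :
  in_H2 f -> in_H2 g -> in_H2 (fun z => Cplus (f z) (Cmult c (g z))).
Proof.
intros [a [Sa Ha]] [b [Sb Hb]].
exists (fun n => Cplus (a n) (Cmult c (b n))); split.
- now apply ssum_lincomb.
- now apply expansion_lincomb.
Qed.

Lemma in_H2_zero : in_H2 (fun _ => 0%C).
Proof.
exists (fun _ => 0%C); split.
- eexists; apply (is_series_single (V := R_NormedModule)) with (n := O).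
  intros k _; rewrite Cmod_0; apply pow_i; lia.
- intros z.
  refine (eq_ind _ (is_series (V := C_NormedModule) _)
            (is_series_single (V := C_NormedModule)
               (fun k => Cmult (pow_n (K := C_AbsRing) (dval z) k) 0) O _) _ _).
  + intros k _; apply Cmult_0_r.
  + apply Cmult_0_r.
Qed.

Lemma in_H2_plus (f g : Disc -> C) :
  in_H2 f -> in_H2 g -> in_H2 (fun z => Cplus (f z) (g z)).
Proof.
intros Hf Hg.
replace (fun z => Cplus (f z) (g z)) with (fun z => Cplus (f z) (Cmult 1 (g z))).
- now apply in_H2_lincomb.
- apply functional_extensionality; intros z; ring.
Qed.

Lemma in_H2_scal (c : C) (f : Disc -> C) :
  in_H2 f -> in_H2 (fun z => Cmult c (f z)).
Proof.
intros Hf.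
replace (fun z => Cmult c (f z)) with (fun z => Cplus 0 (Cmult c (f z))).
- apply (in_H2_lincomb c (fun _ => 0%C)); [apply in_H2_zero | exact Hf].
- apply functional_extensionality; intros z; ring.
Qed.

Lemma in_H2_opp (f : Disc -> C) : in_H2 f -> in_H2 (fun z => Copp (f z)).
Proof.
intros Hf.
replace (fun z => Copp (f z)) with (fun z => Cmult (-1) (f z)).
- now apply in_H2_scal.
- apply functional_extensionality; intros z; ring.
Qed.

Definition H2_zero : H2 := mkH2 (fun _ => 0%C) in_H2_zero.

Definition H2_plus (f g : H2) : H2 :=
  mkH2 (fun z => Cplus (f z) (g z))
    (in_H2_plus f g (hfun_in_H2 f) (hfun_in_H2 g)).

Definition H2_opp (f : H2) : H2 :=
  mkH2 (fun z => Copp (f z)) (in_H2_opp f (hfun_in_H2 f)).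

Definition H2_scal (c : C) (f : H2) : H2 :=
  mkH2 (fun z => Cmult c (f z)) (in_H2_scal c f (hfun_in_H2 f)).

Lemma H2_plusC f g : H2_plus f g = H2_plus g f.
Proof. apply H2_ext; intros z; simpl; ring. Qed.

Lemma H2_plusA f g h : H2_plus f (H2_plus g h) = H2_plus (H2_plus f g) h.
Proof. apply H2_ext; intros z; simpl; ring. Qed.

Lemma H2_plus0 f : H2_plus f H2_zero = f.
Proof. apply H2_ext; intros z; simpl; ring. Qed.

Lemma H2_plusN f : H2_plus f (H2_opp f) = H2_zero.
Proof. apply H2_ext; intros z; simpl; ring. Qed.

Definition H2_AbelianMonoid_mixin :=
  AbelianMonoid.Mixin H2 H2_plus H2_zero H2_plusC H2_plusA H2_plus0.
Canonical H2_AbelianMonoid := AbelianMonoid.Pack H2 H2_AbelianMonoid_mixin H2.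

Definition H2_AbelianGroup_mixin :=
  AbelianGroup.Mixin H2_AbelianMonoid H2_opp H2_plusN.
Canonical H2_AbelianGroup :=
  AbelianGroup.Pack H2 (AbelianGroup.Class _ _ H2_AbelianGroup_mixin) H2.

Lemma H2_scalA (c d : C_Ring) (f : H2_AbelianGroup) :
  H2_scal c (H2_scal d f) = H2_scal (mult c d) f.
Proof. apply H2_ext; intros z; apply Cmult_assoc. Qed.

Lemma H2_scal1 (f : H2_AbelianGroup) : H2_scal (one : C_Ring) f = f.
Proof. apply H2_ext; intros z; apply Cmult_1_l. Qed.

Lemma H2_scalDr (c : C_Ring) (f g : H2_AbelianGroup) :
  H2_scal c (plus f g) = plus (H2_scal c f) (H2_scal c g).
Proof. apply H2_ext; intros z; apply Cmult_plus_distr_l. Qed.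

Lemma H2_scalDl (c d : C_Ring) (f : H2_AbelianGroup) :
  H2_scal (plus c d) f = plus (H2_scal c f) (H2_scal d f).
Proof. apply H2_ext; intros z; apply Cmult_plus_distr_r. Qed.

Definition H2_ModuleSpace_mixin :=
  ModuleSpace.Mixin C_Ring H2_AbelianGroup H2_scal
    H2_scalA H2_scal1 H2_scalDr H2_scalDl.
Canonical H2_ModuleSpace :=
  ModuleSpace.Pack C_Ring H2 (ModuleSpace.Class _ _ _ H2_ModuleSpace_mixin) H2.

Lemma coef_plus (f g : H2) n : coef (plus f g) n = Cplus (coef f n) (coef g n).
Proof.
revert n; apply coef_unique.
- replace (fun n => (coef f n + coef g n)%C)
    with (fun n => (coef f n + 1 * coef g n)%C).
  + apply ssum_lincomb; apply coef_ssum.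
  + apply functional_extensionality; intros n; ring.
- intros z; apply (is_pseries_plus (V := C_NormedModule)); apply coef_expansion.
Qed.

Lemma coef_scal (c : C) (f : H2) n : coef (H2_scal c f) n = Cmult c (coef f n).
Proof.
revert n; apply coef_unique.
- apply (@ex_series_ext R_AbsRing R_NormedModule) with
    (fun n => Cmod c ^ 2 * Cmod (coef f n) ^ 2).
  + intros n; rewrite Cmod_mult, Rpow_mult_distr; reflexivity.
  + apply (ex_series_scal (K := R_AbsRing) (V := R_NormedModule)), coef_ssum.
- intros z; apply (is_pseries_scal (V := C_NormedModule)); [exact (Cmult_comm _ _) |].
  apply coef_expansion.
Qed.

Lemma hdot_self (f : H2) : Re (hdot f f) = Series (fun n => Cmod (coef f n) ^ 2).
Proof.
apply Series_ext; intros n.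
rewrite <- Cmod2_conj; simpl; ring.
Qed.

Lemma hnorm_sqr (f : H2) : hnorm f ^ 2 = Series (fun n => Cmod (coef f n) ^ 2).
Proof.
unfold hnorm; rewrite hdot_self, <- Rsqr_pow2, Rsqr_sqrt; [reflexivity |].
apply Series_nonneg; [intros n; apply pow2_ge_0 | apply coef_ssum].
Qed.

Lemma hnorm_ge_0 (f : H2) : 0 <= hnorm f.
Proof. apply sqrt_pos. Qed.

Lemma hnorm_eq0 (f : H2) : hnorm f = 0 -> f = zero.
Proof.
intros E.
assert (S0 := hnorm_sqr f); rewrite E, pow_i in S0 by auto with arith.
assert (Z : forall n, coef f n = 0%C).
{ intros n; apply Cmod_eq_0.
  assert (T := Series_nonneg_ge_term (fun n => Cmod (coef f n) ^ 2) n
                 (fun k => pow2_ge_0 _) (coef_ssum f)).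
  simpl in T, S0; generalize (Cmod_ge_0 (coef f n)); nra. }
apply H2_ext_coef; intros n; rewrite Z; symmetry.
replace (zero : H2) with (H2_scal 0%C f).
- rewrite coef_scal; ring.
- apply H2_ext; intros z; simpl; ring.
Qed.

Lemma hnorm_scal (c : C) (f : H2) : hnorm (H2_scal c f) = Cmod c * hnorm f.
Proof.
apply Rsqr_inj; [apply hnorm_ge_0 | |].
- apply Rmult_le_pos; [apply Cmod_ge_0 | apply hnorm_ge_0].
- rewrite !Rsqr_pow2, Rpow_mult_distr, !hnorm_sqr, <- Series_scal_l.
  apply Series_ext; intros n.
  now rewrite coef_scal, Cmod_mult, Rpow_mult_distr.
Qed.

Lemma hnorm_triangle (f g : H2) : hnorm (plus f g) <= hnorm f + hnorm g.
Proof.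
destruct (Req_dec (hnorm f) 0) as [f0 | f0].
{ rewrite f0, (hnorm_eq0 f f0), plus_zero_l; lra. }
destruct (Req_dec (hnorm g) 0) as [g0 | g0].
{ rewrite g0, (hnorm_eq0 g g0), plus_zero_r; lra. }
assert (Pf := hnorm_ge_0 f); assert (Pg := hnorm_ge_0 g).
assert (Sf := hnorm_sqr f); assert (Sg := hnorm_sqr g).
set (A := hnorm f) in *; set (B := hnorm g) in *.
assert (A0 : 0 < A) by lra; assert (B0 : 0 < B) by lra.
apply Rsqr_incr_0; [| apply hnorm_ge_0 | lra].
rewrite !Rsqr_pow2, hnorm_sqr.
replace ((A + B) ^ 2) with ((1 + B / A) * A ^ 2 + (1 + A / B) * B ^ 2)
  by (field; lra).
assert (Ef : ex_series (fun n => (1 + B / A) * Cmod (coef f n) ^ 2))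
  by exact (@ex_series_scal R_AbsRing R_NormedModule _ _ (coef_ssum f)).
assert (Eg : ex_series (fun n => (1 + A / B) * Cmod (coef g n) ^ 2))
  by exact (@ex_series_scal R_AbsRing R_NormedModule _ _ (coef_ssum g)).
rewrite Sf, Sg, <- !Series_scal_l, <- (Series_plus _ _ Ef Eg).
apply Series_le; [| exact (ex_series_plus (V := R_NormedModule) _ _ Ef Eg)].
intros n; split; [apply pow2_ge_0 |].
rewrite coef_plus.
assert (T := Cmod_triangle (coef f n) (coef g n)).
assert (U := Cmod_ge_0 (coef f n + coef g n)%C).
set (x := Cmod (coef f n)) in *; set (y := Cmod (coef g n)) in *.
apply Rle_trans with ((x + y) ^ 2); [apply pow_incr; split; assumption |].
change ((x + y) ^ 2 <= (1 + B / A) * x ^ 2 + (1 + A / B) * y ^ 2).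
assert (V : (1 + B / A) * x ^ 2 + (1 + A / B) * y ^ 2 - (x + y) ^ 2
            = (B * x - A * y) ^ 2 / (A * B)) by (field; lra).
assert (W : 0 <= (B * x - A * y) ^ 2 / (A * B)).
{ apply Rdiv_le_0_compat; [apply pow2_ge_0 | now apply Rmult_lt_0_compat]. }
lra.
Qed.

Definition H2_ball (f : H2) (eps : R) (g : H2) : Prop := hnorm (minus g f) < eps.

Lemma H2_ball_center (f : H2) (eps : posreal) : H2_ball f eps f.
Proof.
unfold H2_ball.
assert (E : minus f f = H2_scal 0%C f) by (apply H2_ext; intros z; simpl; ring).
rewrite E, hnorm_scal, Cmod_0, Rmult_0_l; apply cond_pos.
Qed.

Lemma H2_ball_sym (f g : H2) (eps : R) : H2_ball f eps g -> H2_ball g eps f.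
Proof.
unfold H2_ball; intros H.
assert (E : minus f g = H2_scal (-1)%C (minus g f))
  by (apply H2_ext; intros z; simpl; ring).
rewrite E, hnorm_scal, Cmod_R, Rabs_left; lra.
Qed.

Lemma H2_ball_triangle (f g h : H2) (e1 e2 : R) :
  H2_ball f e1 g -> H2_ball g e2 h -> H2_ball f (e1 + e2) h.
Proof.
unfold H2_ball; intros H1 H2.
rewrite (minus_trans g h f).
apply Rle_lt_trans with (1 := hnorm_triangle _ _); lra.
Qed.

Definition H2_UniformSpace_mixin :=
  UniformSpace.Mixin H2 H2_zero H2_ball
    H2_ball_center H2_ball_sym H2_ball_triangle.
Canonical H2_UniformSpace := UniformSpace.Pack H2 H2_UniformSpace_mixin H2.

Canonical H2_NormedModuleAux :=
  NormedModuleAux.Pack C_AbsRing H2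
    (NormedModuleAux.Class C_AbsRing H2
      (ModuleSpace.class C_Ring H2_ModuleSpace) H2_UniformSpace_mixin) H2.

Lemma H2_norm_scal (c : C_AbsRing) (f : H2_NormedModuleAux) :
  hnorm (scal c f) <= abs c * hnorm f.
Proof. right; apply hnorm_scal. Qed.

Lemma H2_norm_ball (f g : H2_NormedModuleAux) (eps : R) :
  hnorm (minus g f) < eps -> ball f eps g.
Proof. exact (fun h => h). Qed.

Lemma H2_ball_norm (f g : H2_NormedModuleAux) (eps : posreal) :
  ball f eps g -> hnorm (minus g f) < 1 * eps.
Proof. rewrite Rmult_1_l; exact (fun h => h). Qed.

Definition H2_NormedModule_mixin :=
  NormedModule.Mixin C_AbsRing H2_NormedModuleAux hnorm 1
    hnorm_triangle H2_norm_scal H2_norm_ball H2_ball_norm hnorm_eq0.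
Canonical H2_NormedModule :=
  NormedModule.Pack C_AbsRing H2
    (NormedModule.Class _ _ _ H2_NormedModule_mixin) H2.

Lemma in_H2_monomial (n : nat) :
  in_H2 (fun z => pow_n (K := C_AbsRing) (dval z) n).
Proof.
set (d := fun k => if Nat.eqb k n then 1%C else 0%C).
assert (dn : d n = 1%C) by (unfold d; now rewrite Nat.eqb_refl).
assert (d0 : forall k, k <> n -> d k = 0%C).
{ intros k Hk; unfold d; apply Nat.eqb_neq in Hk; now rewrite Hk. }
exists d; split.
- eexists; apply (is_series_single (V := R_NormedModule)) with (n := n).
  intros k Hk; rewrite d0, Cmod_0 by exact Hk; apply pow_i; lia.
- intros z.
  replace (pow_n (K := C_AbsRing) (dval z) n)
    with (Cmult (pow_n (K := C_AbsRing) (dval z) n) (d n))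
    by (rewrite dn; apply Cmult_1_r).
  apply (is_series_single (V := C_NormedModule)
           (fun k => Cmult (pow_n (K := C_AbsRing) (dval z) k) (d k))).
  intros k Hk; rewrite d0 by exact Hk; apply Cmult_0_r.
Qed.

Definition monomial (n : nat) : H2 := mkH2 _ (in_H2_monomial n).

(* The first two clauses say that [J] is antilinear. *)
Definition conjugation (V : ModuleSpace C_Ring) (dot : V -> V -> C)
    (J : V -> V) : Prop :=
  (forall f g, J (plus f g) = plus (J f) (J g)) /\
  (forall c f, J (scal c f) = scal (Cconj c) (J f)) /\
  (forall f g, dot (J f) (J g) = dot g f) /\
  (forall f, J (J f) = f).

(* Main.v *)
(* The monomials form an orthonormal basis of [H2], and the conjugation is an
   isometry by (a).  Hence it may be applied termwise to the norm convergent
   series [sum a_n z^n], and [b_m^(n)] is the [m]-th coefficient of [C(z^n)]. *)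
Require Import Defs.
From Stdlib Require Import Reals Lra Lia FunctionalExtensionality.
From Coquelicot Require Import Coquelicot.

Lemma minus_plus_l {G : AbelianGroup} (x y : G) : minus (plus x y) x = y.
Proof.
unfold minus.
rewrite (plus_comm x), <- plus_assoc.
rewrite <- (plus_zero_r y) at 2; f_equal; apply plus_opp_r.
Qed.

Lemma additive_minus {G H : AbelianGroup} (phi : G -> H) :
  (forall x y, phi (plus x y) = plus (phi x) (phi y)) ->
  forall x y, phi (minus x y) = minus (phi x) (phi y).
Proof.
(* Adding [phi y] to both sides leaves only additivity to use; zero and opposites need no separate
   treatment. *)
intros phiD x y; apply plus_reg_r with (phi y).
assert (cancel : forall (A : AbelianGroup) (u v : A), plus (minus u v) v = u).
{ intros A u v; unfold minus; rewrite <- plus_assoc.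
  rewrite <- (plus_zero_r u) at 2; f_equal; apply plus_opp_l. }
transitivity (phi x); [rewrite <- phiD; f_equal | symmetry]; apply cancel.
Qed.

(** A term is a difference of two consecutive partial sums, and these are bounded because they
    converge; hence the bound [M + M]. *)
Lemma is_series_bounded_terms {K : AbsRing} {V : NormedModule K}
    (u : nat -> V) (l : V) :
  is_series u l -> exists M, forall n, norm (u n) <= M.
Proof.
intros Hu.
destruct (filterlim_bounded (sum_n u) (ex_intro _ l Hu)) as [M HM].
exists (M + M); intros n; destruct n as [|n].
- generalize (HM O); rewrite sum_O; generalize (norm_ge_0 (u O)); lra.
- assert (E : u (S n) = minus (sum_n u (S n)) (sum_n u n))
    by (rewrite sum_Sn; symmetry; exact (minus_plus_l (G := NormedModule.AbelianGroup K V) _ _)).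
  rewrite E; apply Rle_trans with (1 := norm_triangle _ _).
  rewrite norm_opp; apply Rplus_le_compat; apply HM.
Qed.

(* Unlike [expansion_unique], nothing is assumed about the size of the
   coefficients: the substitution [z := z / 2] makes them bounded. *)
Lemma expansion_coef (f : H2) (a : nat -> C) :
  power_expansion f a -> forall n, a n = coef f n.
Proof.
intros Ha.
assert (Hd := expansion_lincomb (-1) _ _ _ _ Ha (coef_expansion f)).
set (d := fun n => (a n + -1 * coef f n)%C) in Hd.
assert (half : Cmod (/ 2)%R < 1) by (rewrite Cmod_R, Rabs_pos_eq; lra).
(* [M] bounds the terms [d n / 2^n] of the difference series at the point [1/2]. *)
destruct (is_series_bounded_terms _ _ (Hd (mkDisc _ half))) as [M HM].
(* The series with coefficients [d n / 2^n] at [x] is the series of [d] at [x / 2], which sums to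
   [f - f = 0]. *)
assert (Z : forall n, Cmult (pow_n (K := C_AbsRing) (RtoC (/ 2)) n) (d n) = 0%C).
{ apply (vanishing_expansion_eq0 _ M); [exact HM |].
  intros x Hx.
  assert (x1 : Cmod (RtoC (/ 2) * x)%C < 1)
    by (rewrite Cmod_mult, Cmod_R, Rabs_pos_eq; lra).
  assert (h := Hd (mkDisc _ x1)); simpl in h.
  replace (f (mkDisc _ x1) + -1 * f (mkDisc _ x1))%C with (RtoC 0) in h by ring.
  refine (is_series_ext _ _ _ _ h); intros n.
  assert (P : pow_n (K := C_AbsRing) (RtoC (/ 2) * x)%C n
              = Cmult (pow_n (K := C_AbsRing) (RtoC (/ 2)) n)
                      (pow_n (K := C_AbsRing) x n)).
  { induction n as [|n IH].
    - symmetry; apply Cmult_1_l.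
    - change (((RtoC (/ 2) * x) * pow_n (K := C_AbsRing) (RtoC (/ 2) * x)%C n)%C
        = ((RtoC (/ 2) * pow_n (K := C_AbsRing) (RtoC (/ 2)) n)
           * (x * pow_n (K := C_AbsRing) x n))%C).
      rewrite IH; ring. }
  change (Cmult (pow_n (K := C_AbsRing) (RtoC (/ 2) * x)%C n) (d n)
    = Cmult (pow_n (K := C_AbsRing) x n)
        (Cmult (pow_n (K := C_AbsRing) (RtoC (/ 2)) n) (d n))).
  rewrite P; ring. }
intros n.
assert (D : d n = 0%C).
{ apply Cmod_eq_0; assert (E := f_equal Cmod (Z n)).
  rewrite Cmod_mult, pow_n_Cmod, Cmod_0, Cmod_R, Rabs_pos_eq in E by lra.
  apply Rmult_integral in E; destruct E as [E | E]; [| exact E].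
  generalize (pow_lt (/ 2) n ltac:(lra)); lra. }
replace (a n) with (d n + coef f n)%C by (unfold d; ring).
rewrite D; ring.
Qed.

Lemma coef_monomial (n k : nat) :
  coef (monomial n) k = if Nat.eqb k n then 1%C else 0%C.
Proof.
set (d k := (if Nat.eqb k n then 1%C else 0%C) : C).
change (coef (monomial n) k = d k); symmetry; revert k; apply expansion_coef.
intros z.
assert (E : Cmult (pow_n (K := C_AbsRing) (dval z) n) (d n) = monomial n z)
  by (unfold d; rewrite Nat.eqb_refl; apply Cmult_1_r).
rewrite <- E.
apply (is_series_single (V := C_NormedModule)
         (fun k => Cmult (pow_n (K := C_AbsRing) (dval z) k) (d k))).
intros k Hk; unfold d; apply Nat.eqb_neq in Hk; rewrite Hk; apply Cmult_0_r.
Qed.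

Lemma coef_minus (f g : H2) (k : nat) :
  coef (minus f g) k = (coef f k - coef g k)%C.
Proof.
unfold minus; rewrite coef_plus.
replace (opp g) with (H2_scal (-1)%C g)
  by (apply H2_ext; intros z; simpl; ring).
rewrite coef_scal; ring.
Qed.

Lemma coef_monomial_sum (c : nat -> C) (N k : nat) :
  coef (sum_n (G := H2_AbelianMonoid) (fun m => H2_scal (c m) (monomial m)) N) k
  = if Nat.leb k N then c k else 0%C.
Proof.
induction N as [|N IH].
- rewrite sum_O, coef_scal, coef_monomial.
  destruct k; simpl; ring.
- rewrite sum_Sn, coef_plus, IH, coef_scal, coef_monomial.
  destruct (Nat.leb_spec k N), (Nat.leb_spec k (S N)), (Nat.eqb_spec k (S N));
    try lia; subst; ring.
Qed.

(** The remainder has coefficients [0] up to [N] and [- coef f k] beyond, so its squared norm is a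
    tail of the series of [Cmod (coef f k) ^ 2]. *)
Lemma monomial_series_remainder (f : H2) (N : nat) :
  hnorm (minus (sum_n (G := H2_AbelianMonoid)
                  (fun m => H2_scal (coef f m) (monomial m)) N) f) ^ 2
  = Series (fun k => Cmod (coef f k) ^ 2) - sum_n (fun k => Cmod (coef f k) ^ 2) N.
Proof.
rewrite hnorm_sqr.
set (u := fun k => Cmod (coef f k) ^ 2).
rewrite (Series_ext _ (fun k => if Nat.leb k N then 0 else u k)).
2:{ intros k; rewrite coef_minus, coef_monomial_sum; unfold u.
    destruct (Nat.leb k N).
    - replace (coef f k - coef f k)%C with (RtoC 0) by ring.
      rewrite Cmod_0; ring.
    - replace (0 - coef f k)%C with (- coef f k)%C by ring.
      now rewrite Cmod_opp. }
(* Both series are split at [S N], because [sum_n] up to [N] has [N + 1] terms; in the truncated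
   series these terms vanish. *)
rewrite (Series_incr_n u (S N)); [| lia | apply coef_ssum].
rewrite (Series_incr_n_aux _ (S N)).
- rewrite sum_n_Reals; simpl pred.
  rewrite (Series_ext _ (fun k => u (S N + k)%nat)); [ring |].
  intros k; destruct (Nat.leb_spec (S N + k) N); [lia | reflexivity].
- intros k Hk; destruct (Nat.leb_spec k N); [reflexivity | lia].
Qed.

Lemma is_series_monomial (f : H2) :
  is_series (K := C_AbsRing) (V := H2_NormedModule)
    (fun m => scal (coef f m) (monomial m)) f.
Proof.
apply filterlim_locally; intros eps.
assert (L : is_series (fun k => Cmod (coef f k) ^ 2)
              (Series (fun k => Cmod (coef f k) ^ 2)))
  by (apply Series_correct, coef_ssum).
(* The tolerance is squared because the tail of the real series is the square of the remainder's
   norm. *)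
assert (e2 : 0 < eps ^ 2) by (apply pow_lt, cond_pos).
destruct (proj1 (filterlim_locally _ _) L (mkposreal _ e2)) as [N HN].
exists N; intros n Hn; specialize (HN n Hn).
change (Rabs (sum_n (fun k => Cmod (coef f k) ^ 2) n
              - Series (fun k => Cmod (coef f k) ^ 2)) < eps ^ 2) in HN.
rewrite Rabs_minus_sym, <- monomial_series_remainder in HN.
rewrite Rabs_pos_eq in HN by apply pow2_ge_0.
apply Rsqr_incrst_0; [now rewrite !Rsqr_pow2 | apply hnorm_ge_0 |].
left; apply cond_pos.
Qed.

(** Additivity moves [phi] through partial sums, and the isometry keeps their distance to the limit.
    Asking for additivity rather than linearity lets the lemma cover an antilinear map. *)
Lemma is_series_additive_isometry {K : AbsRing} {U V : NormedModule K}
    (phi : U -> V) (u : nat -> U) (l : U) :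
  (forall x y, phi (plus x y) = plus (phi x) (phi y)) ->
  (forall x, norm (phi x) = norm x) ->
  is_series u l -> is_series (fun n => phi (u n)) (phi l).
Proof.
intros phiD phiN Hu.
assert (phiB : forall x y, phi (minus x y) = minus (phi x) (phi y))
  by (exact (additive_minus (G := NormedModule.AbelianGroup K U)
            (H := NormedModule.AbelianGroup K V) phi phiD)).
assert (phiS : forall N, phi (sum_n u N) = sum_n (fun n => phi (u n)) N).
{ induction N as [|N IH]; [now rewrite !sum_O |].
  now rewrite !sum_Sn, phiD, IH. }
apply filterlim_ext with (1 := phiS).
apply filterlim_locally_ball_norm; intros eps.
generalize (proj1 (filterlim_locally_ball_norm _ _) Hu eps).
apply filter_imp; intros N; unfold ball_norm.
now rewrite <- phiB, phiN.
Qed.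

Theorem proposition6 (J : H2 -> H2) (HJ : conjugation H2_ModuleSpace hdot J) :
  exists b : nat -> nat -> C,
    (forall n : nat, square_summable (b n)) /\
    (forall (f : H2) (a : nat -> C), power_expansion f a ->
       exists g : nat -> H2,
         (forall n : nat,
            is_series (K := C_AbsRing) (V := H2_NormedModule)
              (fun m => scal (Cmult (Cconj (a n)) (b n m)) (monomial m)) (g n)) /\
         is_series (K := C_AbsRing) (V := H2_NormedModule) g (J f)).
Proof.
destruct HJ as [JD [JZ [Jdot _]]].
exists (fun n => coef (J (monomial n))); split.
{ intros n; apply coef_ssum. }
(* Every power expansion of [f] has the coefficients [coef f]. *)
intros f a Ha; assert (E := functional_extensionality _ _ (expansion_coef f a Ha)); subst a.
(* The inner sum is the image of the [n]-th term. By antilinearity it is the conjugate of [coef f n]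
   times [J (monomial n)], whose own monomial expansion supplies the series over [m]. *)
exists (fun n => J (scal (coef f n : C_Ring) (monomial n))); split.
- intros n; rewrite JZ.
  generalize (is_series_scal (K := C_AbsRing) (V := H2_NormedModule)
                (Cconj (coef f n)) _ _ (is_series_monomial (J (monomial n)))).
  apply is_series_ext; intros m.
  exact (scal_assoc (V := H2_ModuleSpace) _ _ _).
- apply (is_series_additive_isometry (U := H2_NormedModule) (V := H2_NormedModule) J).
  + exact JD.
  + intros h; change (hnorm (J h) = hnorm h).
    (* Clause (a) with both arguments equal to [h] gives the isometry. *)
    unfold hnorm; now rewrite Jdot.
  + apply is_series_monomial.
Qed.
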